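(* The logic $\mathbf{QCKL}^{-}$ is sound and complete with respect to the class $\mathcal{C}_{\mathsf{CKL}^{-}}$ of CKL$^{-}$-frames; that is, a formula belongs to $\mathbf{QCKL}^{-}$ if and only if it is valid in every CKL$^{-}$-frame.
   Context: Language: countable set of variables, $\top,\bot,\land,\neg,\forall$, countably many predicate symbols of each arity, and two modal operators $\mathsf{E}$, $\mathsf{C}$; $\mathsf{E}^n$ is the $n$-fold iterate. $\mathbf{QCKL}^{-}$ is the set of formulas derivable from: all classical predicate tautologies; $\Box(p\supset q)\supset(\Box p\supset\Box q)$ for $\Box\in\{\mathsf{E},\mathsf{C}\}$; $\mathsf{C}p\supset\mathsf{E}^np$ for each $n\in\omega$; modus ponens; uniform substitution; necessitation for $\mathsf{E}$ and $\mathsf{C}$; generalization; and the $\omega$-rule: from $\gamma\supset\mathsf{E}^n\phi$ for all $n\in\omega$ infer $\gamma\supset\mathsf{C}\phi$. A bimodal neighborhood frame is $Z=\langle C,\mathcal{N}_{\mathsf{E}},\mathcal{N}_{\mathsf{C}}\rangle$ with $C\neq\emptyset$ and $\mathcal{N}_{\mathsf{E}},\mathcal{N}_{\mathsf{C}}\colon C\to\mathcal{P}(\mathcal{P}(C))$; its complex algebra $\mathsf{Alg}(Z)$ is the power set Boolean algebra of $C$ with operators $\mathsf{E}X=\{c\mid X\in\mathcal{N}_{\mathsf{E}}(c)\}$, $\mathsf{C}X=\{c\mid X\in\mathcal{N}_{\mathsf{C}}(c)\}$. A CKL$^{-}$-algebra is a complete Boolean algebra with unary operators $\mathsf{E},\mathsf{C}$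 each satisfying $\Box(x\land y)=\Box x\land\Box y$ and $\Box1=1$, and such that $\mathsf{C}x=\bigwedge_{n\in\omega}\mathsf{E}^nx$ for all $x$. $Z$ is a CKL$^{-}$-frame if $\mathsf{Alg}(Z)$ is a CKL$^{-}$-algebra. A formula is valid in $Z$ if for every nonempty (constant) domain $\mathcal{D}$, interpretation $\mathcal{I}$ ($P^{\mathcal{I}}(c)\subseteq\mathcal{D}^n$) and assignment $\mathcal{A}$, its valuation equals $C$, where valuation is: atomic formulas $P(x_1,\ldots,x_n)\mapsto\{c\mid(\mathcal{A}(x_1),\ldots,\mathcal{A}(x_n))\in P^{\mathcal{I}}(c)\}$, $\top\mapsto C$, $\bot\mapsto\emptyset$, Boolean connectives set-theoretically, $\forall x\phi\mapsto\bigcap_{d\in\mathcal{D}}v_{[d/x]\mathcal{A}}(\phi)$, $\mathsf{E}\phi\mapsto\{c\mid v(\phi)\in\mathcal{N}_{\mathsf{E}}(c)\}$, $\mathsf{C}\phi\mapsto\{c\mid v(\phi)\in\mathcal{N}_{\mathsf{C}}(c)\}$. *)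

(* Defs.v *)
From HB Require Import structures.
From mathcomp Require Import all_boot all_order.
From mathcomp Require Import boolp classical_sets.

Set Implicit Arguments.
Unset Strict Implicit.
Unset Printing Implicit Defensive.

Import Order.TTheory.
Local Open Scope classical_set_scope.

(* Variables are natural numbers, and [Atom k xs] with [xs : n.-tuple nat] is
   the k-th predicate symbol of arity n applied to the variables xs.
   Propositional variables are the predicate symbols of arity 0. *)
Inductive form : Type :=
| Atom (n k : nat) (xs : n.-tuple nat)
| Top
| Bot
| And (phi psi : form)
| Neg (phi : form)
| All (x : nat) (phi : form)
| EBox (phi : form)
| CBox (phi : form).

Definition Imp (phi psi : form) : form := Neg (And phi (Neg psi)).

Definition PVar (k : nat) : form := Atom k [tuple].

Fixpoint fv (phi : form) : seq nat :=
  match phi with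
  | Atom _ _ xs => xs
  | Top | Bot => [::]
  | And phi psi => fv phi ++ fv psi
  | Neg phi | EBox phi | CBox phi => fv phi
  | All x phi => [seq y <- fv phi | y != x]
  end.

(* [x] itself when it does not occur in [avoid], a fresh variable otherwise. *)
Definition fresh (avoid : seq nat) (x : nat) : nat :=
  if x \in avoid then (\max_(y <- avoid) y).+1 else x.

(* Capture-avoiding replacement of the free variables of a formula. *)
Fixpoint rename (s : nat -> nat) (phi : form) : form :=
  match phi with
  | Atom _ k xs => Atom k (map_tuple s xs)
  | Top => Top
  | Bot => Bot
  | And phi psi => And (rename s phi) (rename s psi)
  | Neg phi => Neg (rename s phi)
  | All x phi =>
      let z := fresh (map s [seq y <- fv phi | y != x]) x in
      All z (rename [eta s with x |-> z] phi)
  | EBox phi => EBox (rename s phi)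
  | CBox phi => CBox (rename s phi)
  end.

(* A formula with distinguished distinct variables x_1, ..., x_n, to be
   substituted for an n-ary predicate symbol; its body may contain free
   variables other than the x_i. *)
Record abstraction (n : nat) : Type := Abstraction {
  params : n.-tuple nat;
  body : form;
  uniq_params : uniq params
}.

Definition instantiate (n : nat) (a : abstraction n) (ys : n.-tuple nat) :
    form :=
  rename (fun z => if z \in params a then nth 0 ys (index z (params a)) else z)
    (body a).

Definition substitution : Type := forall n : nat, nat -> abstraction n.

(* Variables that applying [sigma] to [phi] introduces besides those of [phi]. *)
Fixpoint subst_fv (sigma : substitution) (phi : form) : seq nat :=
  match phi with
  | Atom n k _ =>
      [seq y <- fv (body (sigma n k)) | y \notin params (sigma n k)]
  | Top | Bot => [::]
  | And phi psi => subst_fv sigma phi ++ subst_fv sigma psi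
  | Neg phi | All _ phi | EBox phi | CBox phi => subst_fv sigma phi
  end.

(* Simultaneous substitution of [sigma] for the predicate symbols of [phi],
   where [s] records the bound variables renamed so far. *)
Fixpoint psubst_rec (sigma : substitution) (s : nat -> nat) (phi : form) :
    form :=
  match phi with
  | Atom n k xs => instantiate (sigma n k) (map_tuple s xs)
  | Top => Top
  | Bot => Bot
  | And phi psi => And (psubst_rec sigma s phi) (psubst_rec sigma s psi)
  | Neg phi => Neg (psubst_rec sigma s phi)
  | All x phi =>
      let z := fresh (map s [seq y <- fv phi | y != x] ++ subst_fv sigma phi) x
      in All z (psubst_rec sigma [eta s with x |-> z] phi)
  | EBox phi => EBox (psubst_rec sigma s phi)
  | CBox phi => CBox (psubst_rec sigma s phi)
  end.

Definition psubst (sigma : substitution) (phi : form) : form :=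
  psubst_rec sigma id phi.

Fixpoint modal_free (phi : form) : bool :=
  match phi with
  | Atom _ _ _ | Top | Bot => true
  | And phi psi => modal_free phi && modal_free psi
  | Neg phi | All _ phi => modal_free phi
  | EBox _ | CBox _ => false
  end.

(* Tarskian satisfaction; the modal clauses are junk, since only modal-free
   formulas are evaluated. *)
Fixpoint sat (D : Type) (J : forall n : nat, nat -> set (n.-tuple D))
    (A : nat -> D) (phi : form) : Prop :=
  match phi with
  | Atom n k xs => J n k (map_tuple A xs)
  | Top => True
  | Bot => False
  | And phi psi => sat J A phi /\ sat J A psi
  | Neg phi => ~ sat J A phi
  | All x phi => forall d : D, sat J [eta A with x |-> d] phi
  | EBox _ | CBox _ => False
  end.

Definition tautology (phi : form) : Prop :=
  modal_free phi /\
  forall (D : Type), [set: D] !=set0 ->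
  forall (J : forall n : nat, nat -> set (n.-tuple D)) (A : nat -> D),
    sat J A phi.

Inductive QCKLm : form -> Prop :=
| QCKLm_taut phi : tautology phi -> QCKLm phi
| QCKLm_KE :
    QCKLm (Imp (EBox (Imp (PVar 0) (PVar 1)))
               (Imp (EBox (PVar 0)) (EBox (PVar 1))))
| QCKLm_KC :
    QCKLm (Imp (CBox (Imp (PVar 0) (PVar 1)))
               (Imp (CBox (PVar 0)) (CBox (PVar 1))))
| QCKLm_CE (n : nat) : QCKLm (Imp (CBox (PVar 0)) (iter n EBox (PVar 0)))
| QCKLm_MP phi psi : QCKLm phi -> QCKLm (Imp phi psi) -> QCKLm psi
| QCKLm_subst sigma phi : QCKLm phi -> QCKLm (psubst sigma phi)
| QCKLm_necE phi : QCKLm phi -> QCKLm (EBox phi)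
| QCKLm_necC phi : QCKLm phi -> QCKLm (CBox phi)
| QCKLm_gen x phi : QCKLm phi -> QCKLm (All x phi)
| QCKLm_omega gamma phi :
    (forall n : nat, QCKLm (Imp gamma (iter n EBox phi))) ->
    QCKLm (Imp gamma (CBox phi)).

Definition complete_lattice (d : Order.disp_t) (B : ctbDistrLatticeType d) :
    Prop :=
  forall S : set B, supremums S !=set0 /\ infimums S !=set0.

Definition normal_operator (d : Order.disp_t) (B : ctbDistrLatticeType d)
    (box : B -> B) : Prop :=
  (forall x y : B, box (x `&` y)%O = (box x `&` box y)%O) /\
  box \top%O = \top%O.

Definition CKLm_algebra (d : Order.disp_t) (B : ctbDistrLatticeType d)
    (E C : B -> B) : Prop :=
  [/\ complete_lattice B, normal_operator E, normal_operator C &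
      forall x : B, infimums (range (fun n : nat => iter n E x)) (C x)].

Record nbhd_frame : Type := NbhdFrame {
  world : Type;
  world_neq0 : [set: world] !=set0;
  NE : world -> set (set world);
  NC : world -> set (set world)
}.

Definition alg_E (Z : nbhd_frame) (X : set (world Z)) : set (world Z) :=
  [set c | NE c X].

Definition alg_C (Z : nbhd_frame) (X : set (world Z)) : set (world Z) :=
  [set c | NC c X].

(* The complex algebra is the library's Boolean algebra structure on
   [set (world Z)], which is ordered by inclusion, with [alg_E] and [alg_C]. *)
Definition CKLm_frame (Z : nbhd_frame) : Prop :=
  @CKLm_algebra _ (set (world Z)) (@alg_E Z) (@alg_C Z).

Fixpoint value (Z : nbhd_frame) (D : Type)
    (I : forall n : nat, nat -> world Z -> set (n.-tuple D))
    (A : nat -> D) (phi : form) : set (world Z) :=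
  match phi with
  | Atom n k xs => [set c | I n k c (map_tuple A xs)]
  | Top => setT
  | Bot => set0
  | And phi psi => value I A phi `&` value I A psi
  | Neg phi => ~` value I A phi
  | All x phi => \bigcap_(d in [set: D]) value I [eta A with x |-> d] phi
  | EBox phi => [set c | NE c (value I A phi)]
  | CBox phi => [set c | NC c (value I A phi)]
  end.

Definition valid (Z : nbhd_frame) (phi : form) : Prop :=
  forall (D : Type), [set: D] !=set0 ->
  forall (I : forall n : nat, nat -> world Z -> set (n.-tuple D))
         (A : nat -> D),
    value I A phi = setT.

(* Main.v *)
(** Soundness is an induction on derivations, the only delicate rule being
    uniform substitution.  For completeness, the worlds are the ultrafilters of
    the Lindenbaum algebra that preserve the meets
    [CBox phi = /\_n EBox^n phi] and [All x phi = /\_y phi[y/x]]; as formulas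
    are countable, the Rasiowa-Sikorski construction provides enough of them.
    A set of worlds is an E-neighborhood of [w] when it contains the truth set
    of some [psi] with [EBox psi] in [w].  The C-neighborhoods are then forced
    by the frame condition, and [w] preserving the first kind of meets is what
    makes them agree with membership of [CBox phi].  The domain consists of the
    variables, so that preserving the second kind settles the quantifier. *)

Require Import Defs.
From mathcomp Require Import all_boot all_order.
From mathcomp Require Import boolp classical_sets.

Set Implicit Arguments.
Unset Strict Implicit.
Unset Printing Implicit Defensive.

Import Order.TTheory.
Local Open Scope classical_set_scope.

(** * Fresh variables and capture-avoiding renaming *)

Lemma fresh_notin (avoid : seq nat) (x : nat) : fresh avoid x \notin avoid.
Proof.
rewrite /fresh; case: ifPn => // _; apply/negP => h.
by have := @leq_bigmax_seq _ avoid xpredT id _ h isT; rewrite ltnn.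
Qed.

Lemma fresh_id (avoid : seq nat) (x : nat) :
  x \notin avoid -> fresh avoid x = x.
Proof. by rewrite /fresh => /negbTE ->. Qed.

Lemma eq_map_tuple_in (T U : eqType) (n : nat) (f g : T -> U) (t : n.-tuple T) :
  {in t, f =1 g} -> map_tuple f t = map_tuple g t.
Proof. by move=> fg; apply/val_inj/eq_in_map. Qed.

Lemma map_tuple_id_in (T : eqType) (n : nat) (f : T -> T) (t : n.-tuple T) :
  {in t, f =1 id} -> map_tuple f t = t.
Proof. by move=> fg; apply/val_inj/map_id_in. Qed.

Lemma eq_rename (phi : form) (s t : nat -> nat) :
  {in fv phi, s =1 t} -> rename s phi = rename t phi.
Proof.
elim: phi s t => [n k xs| | |a IHa b IHb|a IHa|x a IHa|a IHa|a IHa] s t st //=.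
- by rewrite (eq_map_tuple_in st).
- by rewrite (IHa s t) ?(IHb s t) // => y yf; apply: st; rewrite mem_cat yf ?orbT.
- by rewrite (IHa s t).
- have -> : map s [seq y <- fv a | y != x] = map t [seq y <- fv a | y != x].
    by apply/eq_in_map.
  congr All; apply: IHa => y ya /=; case: eqVneq => // yx.
  by apply: st; rewrite /= mem_filter yx.
- by rewrite (IHa s t).
- by rewrite (IHa s t).
Qed.

(** [fresh] changes a bound variable only in case of a clash, so this is a syntactic equality, not
    just one up to bound variables. *)
Lemma rename_id (phi : form) (s : nat -> nat) :
  {in fv phi, s =1 id} -> rename s phi = phi.
Proof.
elim: phi s => [n k xs| | |a IHa b IHb|a IHa|x a IHa|a IHa|a IHa] s sid //=.
- by rewrite map_tuple_id_in.
- by rewrite IHa ?IHb // => y yf; apply: sid; rewrite mem_cat yf ?orbT.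
- by rewrite IHa.
- have -> : map s [seq y <- fv a | y != x] = [seq y <- fv a | y != x].
    exact: map_id_in.
  rewrite fresh_id ?mem_filter ?eqxx // IHa // => y ya /=.
  by case: eqVneq => // yx; apply: sid; rewrite /= mem_filter yx.
- by rewrite IHa.
- by rewrite IHa.
Qed.

Lemma mem_fv_rename (phi : form) (s : nat -> nat) :
  fv (rename s phi) =i map s (fv phi).
Proof.
elim: phi s => [n k xs| | |a IHa b IHb|a IHa|x a IHa|a IHa|a IHa] s //= y.
- by rewrite map_cat !mem_cat IHa IHb.
- rewrite mem_filter IHa; set z := fresh _ _.
  have zN : z \notin map s [seq y <- fv a | y != x] by exact: fresh_notin.
  apply/andP/mapP => [[yz /mapP[u ua /= yu]]|[u]].
    case: (eqVneq u x) yu yz => [_ ->|ux -> _]; first by rewrite eqxx.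
    by exists u; rewrite ?mem_filter ?ux.
  move=> uf yu; split.
    by apply: contraNneq zN => <-; rewrite yu map_f.
  move: uf; rewrite mem_filter => /andP[ux ua].
  by apply/mapP; exists u => //=; rewrite (negbTE ux).
Qed.

(** * Soundness *)

Section Value.
Variables (Z : nbhd_frame) (D : Type).
Implicit Types (I : forall n : nat, nat -> world Z -> set (n.-tuple D)).
Implicit Types (A B : nat -> D) (phi : form).

Lemma eq_value I A B phi : {in fv phi, A =1 B} -> value I A phi = value I B phi.
Proof.
elim: phi A B => [n k xs| | |a IHa b IHb|a IHa|x a IHa|a IHa|a IHa] A B AB //=.
- by have -> : map_tuple A xs = map_tuple B xs by apply/val_inj/eq_in_map.
- by rewrite (IHa A B) ?(IHb A B) // => y yf; apply: AB; rewrite mem_cat yf ?orbT.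
- by rewrite (IHa A B).
- apply: eq_bigcapr => d _; apply: IHa => y ya /=; case: eqVneq => // yx.
  by apply: AB; rewrite /= mem_filter yx.
- by rewrite (IHa A B).
- by rewrite (IHa A B).
Qed.

Lemma value_rename I A (s : nat -> nat) phi :
  value I A (rename s phi) = value I (A \o s) phi.
Proof.
elim: phi A s => [n k xs| | |a IHa b IHb|a IHa|x a IHa|a IHa|a IHa] A s //=;
  rewrite ?IHa ?IHb //.
- suff -> : map_tuple A (map_tuple s xs) = map_tuple (A \o s) xs by [].
  by apply: val_inj; rewrite /= map_comp.
- apply: eq_bigcapr => d _; rewrite IHa; apply: eq_value => y ya /=.
  set z := fresh _ _; case: (eqVneq y x) => [_|yx] /=; first by rewrite eqxx.
  have zN : z \notin map s [seq y <- fv a | y != x] by exact: fresh_notin.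
  case: eqVneq => // syz; move: zN; rewrite -syz map_f //.
  by rewrite mem_filter yx.
Qed.

(** Free variables of the body other than the parameters are read in [B]. The default [B 0] is never
    reached: the index of a parameter is below [n]. *)
Definition subst_interp (sigma : substitution) I (B : nat -> D) (n k : nat)
    (c : world Z) : set (n.-tuple D) :=
  [set ds | value I (fun z => if z \in params (sigma n k)
                    then nth (B 0) ds (index z (params (sigma n k))) else B z)
              (body (sigma n k)) c].

(* Under the binder [All z], [A] changes at [z] while the interpretation of the
   predicate symbols must not: hence two assignments, which need only agree on
   the variables brought in by [sigma]. *)
Lemma value_psubst_rec (sigma : substitution) I A B (s : nat -> nat) phi :
  {in subst_fv sigma phi, A =1 B} ->
  value I A (psubst_rec sigma s phi) =
  value (subst_interp sigma I B) (A \o s) phi.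
Proof.
elim: phi A s => [n k xs| | |a IHa b IHb|a IHa|x a IHa|a IHa|a IHa] A s AB //=.
- rewrite /instantiate value_rename.
  transitivity (value I (fun z => if z \in params (sigma n k)
       then nth (B 0) (map_tuple (A \o s) xs) (index z (params (sigma n k)))
       else B z) (body (sigma n k))); last by [].
  apply: eq_value => y yb /=; case: ifPn => yp.
    have lt : index y (params (sigma n k)) < size xs.
      by rewrite size_tuple -[X in _ < X](size_tuple (params (sigma n k))) index_mem.
    by rewrite !(nth_map 0).
  by apply: AB; rewrite /= mem_filter yp.
- by rewrite IHa ?IHb // => y yf; apply: AB; rewrite /= mem_cat yf ?orbT.
- by rewrite IHa.
- apply: eq_bigcapr => d _; set z := fresh _ _.
  have := fresh_notin (map s [seq y <- fv a | y != x] ++ subst_fv sigma a) x.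
  rewrite -/z mem_cat negb_or => /andP[zs zf].
  (* [zf] keeps the assignment updated at [z] in agreement with [B]; [zs] excludes capture of the
     other free variables. *)
  rewrite IHa => [|y yf /=].
    apply: eq_value => y ya /=.
    case: (eqVneq y x) => [_|yx] /=; first by rewrite eqxx.
    case: eqVneq => // syz; move: zs; rewrite -syz map_f //.
    by rewrite mem_filter yx.
  case: eqVneq => [yz|_]; first by move: zf; rewrite -yz yf.
  exact: AB.
- by rewrite IHa.
- by rewrite IHa.
Qed.

Lemma value_Imp I A phi psi :
  value I A (Imp phi psi) = setT <-> value I A phi `<=` value I A psi.
Proof.
split=> /= [h c hp|h].
  by apply: contrapT => hq; have : (setT : set (world Z)) c by []; rewrite -h => -[].
by apply/seteqP; split=> // c _ [hp]; apply; apply: h.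
Qed.

(** At a fixed world only the structure attached to that world matters, so predicate tautologies
    hold world by world. *)
Lemma value_modal_free I A phi (c : world Z) : modal_free phi ->
  value I A phi c <-> sat (fun n k => I n k c) A phi.
Proof.
elim: phi A => [n k xs| | |a IHa b IHb|a IHa|x a IHa|a IHa|a IHa] A //=.
- by move=> /andP[ha hb]; split=> -[? ?]; split; by [apply/IHa|apply/IHb].
- by move=> ha; split=> h h'; apply: h; apply/IHa.
- by move=> ha; split=> h d; [apply/IHa => //; apply: h|move=> _; apply/IHa].
Qed.

Lemma value_iterE I A phi (n : nat) :
  value I A (iter n EBox phi) = iter n (@alg_E Z) (value I A phi).
Proof. by elim: n => //= n ->. Qed.

End Value.

(** The implication set meets [X] in the intersection of [X] and [Y], so preservation of binary
    meets yields axiom K. *)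
Lemma normal_operator_K (T : Type) (box : set T -> set T) (X Y : set T) :
  @normal_operator _ (set T) box ->
  box (~` (X `&` ~` Y)) `&` box X `<=` box Y.
Proof.
move=> [hI _] c h.
have : box (~` (X `&` ~` Y) `&` X) c by have := hI (~` (X `&` ~` Y)) X => ->.
suff -> : ~` (X `&` ~` Y) `&` X = X `&` Y.
  by have := hI X Y => ->; case.
apply/seteqP; split=> [d [hn hx]|d [hx hy]]; split=> //.
  by apply: contrapT => hy; apply: hn.
by case.
Qed.

Lemma soundness (phi : form) (Z : nbhd_frame) :
  CKLm_frame Z -> QCKLm phi -> valid Z phi.
Proof.
move=> [_ nE nC inf]; elim=> {phi}.
- move=> phi [mf taut] D D0 I A; apply/seteqP; split=> // c _.
  by apply/value_modal_free => //; apply: taut.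
- move=> D D0 I A; apply/value_Imp => c hE /= [hp hq]; apply: hq.
  exact: (normal_operator_K nE) (conj hE hp).
- move=> D D0 I A; apply/value_Imp => c hC /= [hp hq]; apply: hq.
  exact: (normal_operator_K nC) (conj hC hp).
- move=> n D D0 I A; apply/value_Imp; rewrite value_iterE /=.
  by have [lb _] := inf (value I A (PVar 0)); apply/subsetPset/lb; exists n.
- move=> phi psi _ Vphi _ Vimp D D0 I A; apply/seteqP; split=> // c _.
  by have /value_Imp := Vimp D D0 I A; apply; rewrite Vphi.
- move=> sigma phi _ Vphi D D0 I A.
  by rewrite /psubst (value_psubst_rec _ _ (B := A)) // Vphi.
- by move=> phi _ Vphi D D0 I A /=; rewrite Vphi //; case: nE.
- by move=> phi _ Vphi D D0 I A /=; rewrite Vphi //; case: nC.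
- move=> x phi _ Vphi D D0 I A /=.
  by apply/seteqP; split=> // c _ d _; rewrite Vphi.
- move=> gamma phi _ Vphi D D0 I A; apply/value_Imp.
  (* The omega-rule says that [CBox phi] is the greatest lower bound of the iterates. *)
  have [_ glb] := inf (value I A phi); apply/subsetPset/glb => _ [n _ <-].
  rewrite -value_iterE; apply/subsetPset/value_Imp.
  exact: Vphi.
Qed.

(** * Derivations *)

(** The leading number tags the constructor. Codes name the propositional variables of skeletons and
    later enumerate the formulas. *)
Fixpoint code (phi : form) : nat :=
  match phi with
  | Atom n k xs => pickle (0, n, k, tval xs)
  | Top => pickle (1, 0, 0, [::] : seq nat)
  | Bot => pickle (2, 0, 0, [::] : seq nat)
  | And phi psi => pickle (3, code phi, code psi, [::] : seq nat)
  | Neg phi => pickle (4, code phi, 0, [::] : seq nat)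
  | All x phi => pickle (5, x, code phi, [::] : seq nat)
  | EBox phi => pickle (6, code phi, 0, [::] : seq nat)
  | CBox phi => pickle (7, code phi, 0, [::] : seq nat)
  end.

Lemma code_inj : injective code.
Proof.
elim=> [n k xs| | |a IHa b IHb|a IHa|x a IHa|a IHa|a IHa] [m l ys| | |c d|c|y c|c|c] /=;
  move=> /(pcan_inj pickleK) // [].
(* The arities are identified first, so that both tuples have the same type. *)
- move=> nm; case: m / nm ys => ys -> xy; congr Atom; exact: val_inj.
- by move=> /IHa -> /IHb ->.
- by move=> /IHa ->.
- by move=> -> /IHa ->.
- by move=> /IHa ->.
- by move=> /IHa ->.
Qed.

Lemma code_decode : exists decode : nat -> form, cancel code decode.
Proof.
have ex n : exists psi, forall phi, code phi = n -> psi = phi.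
  have [[psi <-]|no] := pselect (exists psi, code psi = n).
    by exists psi => phi /code_inj.
  by exists Top => phi nE; case: no; exists phi.
have [decode h] := choice ex.
by exists decode => phi; apply: h.
Qed.

Definition const_abs (phi : form) : abstraction 0 :=
  @Abstraction 0 [tuple] phi isT.

Definition unary_abs (x : nat) (phi : form) : abstraction 1 :=
  @Abstraction 1 [tuple x] phi isT.

Definition low_subst (d : nat -> form) (x : nat) (phi : form) : substitution :=
  fun n k => match n with
  | 0 => const_abs (d k)
  | 1 => unary_abs x phi
  | n => @Abstraction n (iota_tuple n 0) Top (iota_uniq 0 n)
  end.

Lemma instantiate_const (phi : form) (t : 0.-tuple nat) :
  instantiate (const_abs phi) t = phi.
Proof. exact: rename_id. Qed.

Lemma instantiate_unary (x y : nat) (phi : form) (t : 1.-tuple nat) :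
  thead t = y ->
  instantiate (unary_abs x phi) t = rename [eta id with x |-> y] phi.
Proof.
move=> <-; case/tupleP: t => u t; rewrite theadE; apply: eq_rename => z _ /=.
by rewrite inE (eq_sym x z); case: eqVneq.
Qed.

Lemma rename_update_id (x : nat) (phi : form) :
  rename [eta id with x |-> x] phi = phi.
Proof. by apply: rename_id => y _ /=; case: eqVneq. Qed.

(** * Propositional reasoning *)

(** Atomic, quantified and modal formulas are unconstrained; the canonical worlds will be valuations
    of this kind. *)
Definition boolean_valuation (v : form -> Prop) : Prop :=
  [/\ v Top, ~ v Bot, forall a b, v (And a b) <-> v a /\ v b &
      forall a, v (Neg a) <-> ~ v a].

Lemma boolean_valuation_Imp (v : form -> Prop) (a b : form) :
  boolean_valuation v -> v (Imp a b) <-> (v a -> v b).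
Proof.
move=> [_ _ vA vN]; split=> [/vN h va|h].
  by apply: contrapT => vb; apply/h/vA; split=> //; apply/vN.
by apply/vN => /vA[/h vb /vN].
Qed.

(* Every formula is a substitution instance of its skeleton, in which maximal
   non-Boolean subformulas are replaced by propositional variables. *)
Fixpoint skeleton (phi : form) : form :=
  match phi with
  | Top => Top
  | Bot => Bot
  | And phi psi => And (skeleton phi) (skeleton psi)
  | Neg phi => Neg (skeleton phi)
  | _ => PVar (code phi)
  end.

Lemma skeleton_modal_free (phi : form) : modal_free (skeleton phi).
Proof. by elim: phi => //= a -> b ->. Qed.

Lemma psubst_skeleton (decode : nat -> form) (phi : form) :
  cancel code decode -> psubst (low_subst decode 0 Top) (skeleton phi) = phi.
Proof.
rewrite /psubst => dK.
elim: phi => [n k xs| | |a IHa b IHb|a IHa|x a IHa|a IHa|a IHa];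
  rewrite /= ?IHa ?IHb // instantiate_const.
- exact: (dK (Atom k xs)).
- exact: (dK (All x a)).
- exact: (dK (EBox a)).
- exact: (dK (CBox a)).
Qed.

(** Each structure induces the Boolean valuation [sat J A (skeleton psi)], so the skeleton of [phi]
    is a tautology, and [phi] is an instance of it. *)
Lemma QCKLm_prop (phi : form) :
  (forall v, boolean_valuation v -> v phi) -> QCKLm phi.
Proof.
move=> vphi; have [decode dK] := code_decode.
rewrite -(psubst_skeleton phi dK); apply/QCKLm_subst/QCKLm_taut.
split=> [|D D0 J A]; first exact: skeleton_modal_free.
by apply: (vphi (fun psi => sat J A (skeleton psi))); split=> //= -[].
Qed.

Lemma QCKLm_prop1 (a phi : form) : QCKLm a ->
  (forall v, boolean_valuation v -> v a -> v phi) -> QCKLm phi.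
Proof.
move=> ha h; apply: (QCKLm_MP ha); apply: QCKLm_prop => v bv.
by apply/(boolean_valuation_Imp _ _ bv); apply: h.
Qed.

Lemma QCKLm_prop2 (a b phi : form) : QCKLm a -> QCKLm b ->
  (forall v, boolean_valuation v -> v a -> v b -> v phi) -> QCKLm phi.
Proof.
move=> ha hb h; apply: (QCKLm_MP hb); apply: (QCKLm_prop1 ha) => v bv va.
by apply/(boolean_valuation_Imp _ _ bv); apply: h.
Qed.

Lemma QCKLm_trans (a b c : form) :
  QCKLm (Imp a b) -> QCKLm (Imp b c) -> QCKLm (Imp a c).
Proof.
move=> ab bc; apply: (QCKLm_prop2 ab bc) => v bv.
by rewrite !boolean_valuation_Imp // => f g /f /g.
Qed.

Lemma QCKLm_id (a : form) : QCKLm (Imp a a).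
Proof. by apply: QCKLm_prop => v bv; apply/boolean_valuation_Imp. Qed.

(** * Modal and quantifier principles *)

Lemma QCKLm_E_K (a b : form) :
  QCKLm (Imp (EBox (Imp a b)) (Imp (EBox a) (EBox b))).
Proof.
have := QCKLm_subst (low_subst (nth Top [:: a; b]) 0 Top) QCKLm_KE.
by rewrite /psubst /= !instantiate_const.
Qed.

Lemma QCKLm_C_K (a b : form) :
  QCKLm (Imp (CBox (Imp a b)) (Imp (CBox a) (CBox b))).
Proof.
have := QCKLm_subst (low_subst (nth Top [:: a; b]) 0 Top) QCKLm_KC.
by rewrite /psubst /= !instantiate_const.
Qed.

Lemma QCKLm_E_mono (a b : form) :
  QCKLm (Imp a b) -> QCKLm (Imp (EBox a) (EBox b)).
Proof. by move=> /QCKLm_necE/QCKLm_MP; apply; apply: QCKLm_E_K. Qed.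

Lemma QCKLm_C_mono (a b : form) :
  QCKLm (Imp a b) -> QCKLm (Imp (CBox a) (CBox b)).
Proof. by move=> /QCKLm_necC/QCKLm_MP; apply; apply: QCKLm_C_K. Qed.

Lemma psubst_rec_iterE sigma s (n : nat) (phi : form) :
  psubst_rec sigma s (iter n EBox phi) = iter n EBox (psubst_rec sigma s phi).
Proof. by elim: n => //= n ->. Qed.

Lemma QCKLm_C_iterE (n : nat) (a : form) :
  QCKLm (Imp (CBox a) (iter n EBox a)).
Proof.
have := QCKLm_subst (low_subst (fun=> a) 0 Top) (QCKLm_CE n).
by rewrite /psubst /= psubst_rec_iterE /= !instantiate_const.
Qed.

Lemma QCKLm_inst (x y : nat) (phi : form) :
  QCKLm (Imp (All x phi) (rename [eta id with x |-> y] phi)).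
Proof.
have taut : tautology (Imp (All x (Atom 0 [tuple x])) (Atom 0 [tuple y])).
  split=> // D D0 J A /= [h]; apply; have := h (A y).
  suff -> : map_tuple [eta A with x |-> A y] [tuple x] = map_tuple A [tuple y] by [].
  by apply: val_inj; rewrite /= eqxx.
have := QCKLm_subst (low_subst (fun=> Top) x phi) (QCKLm_taut taut).
(* As [x] is the parameter of the abstraction, it causes no clash and the binder keeps its name. *)
rewrite /psubst /= eqxx /= fresh_id; last first.
  by rewrite mem_filter inE eqxx.
rewrite (@instantiate_unary x x) ?(@instantiate_unary x y) //.
  by rewrite rename_update_id.
by rewrite /thead tnth_map (tnth_nth 0) /= eqxx.
Qed.

Lemma QCKLm_all_Imp (x : nat) (gamma phi : form) : x \notin fv gamma ->
  QCKLm (Imp (All x (Imp gamma phi)) (Imp gamma (All x phi))).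
Proof.
move=> xg.
have taut : tautology (Imp (All x (Imp (PVar 0) (Atom 0 [tuple x])))
    (Imp (PVar 0) (All x (Atom 0 [tuple x])))).
  split=> // D D0 J A /= [h]; apply=> -[h0]; apply=> d.
  apply: contrapT => h1; apply: (h d); split=> //.
  suff -> : map_tuple [eta A with x |-> d] [tuple] = map_tuple A [tuple] by [].
  by apply: val_inj.
have := QCKLm_subst (low_subst (fun=> gamma) x phi) (QCKLm_taut taut).
have xN : x \notin [seq y <- fv phi | y \notin [tuple x]].
  by rewrite mem_filter inE eqxx.
(* The side condition enters here: with [x] free in [gamma], the substitution would rename the
   binder. *)
have xG : x \notin [seq y <- fv gamma | y \notin [tuple]].
  by rewrite mem_filter (negbTE xg) andbF.
rewrite /psubst /= eqxx /= !fresh_id ?mem_cat ?negb_or ?xN ?xG //.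
rewrite !instantiate_const !(@instantiate_unary x x) ?rename_update_id //.
by rewrite /thead tnth_map (tnth_nth 0) /= eqxx.
Qed.

Lemma QCKLm_gen_Imp (x : nat) (gamma phi : form) : x \notin fv gamma ->
  QCKLm (Imp gamma phi) -> QCKLm (Imp gamma (All x phi)).
Proof.
by move=> xg /(QCKLm_gen x) /QCKLm_MP; apply; apply: QCKLm_all_Imp.
Qed.

Lemma notin_fv_All (x : nat) (phi : form) : x \notin fv (All x phi).
Proof. by rewrite /= mem_filter eqxx. Qed.

Lemma QCKLm_All_mono (x : nat) (a b : form) :
  QCKLm (Imp a b) -> QCKLm (Imp (All x a) (All x b)).
Proof.
move=> ab; apply: QCKLm_gen_Imp; first exact: notin_fv_All.
by apply: QCKLm_trans ab; have := QCKLm_inst x x a; rewrite rename_update_id.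
Qed.

(** The two sides may pick different bound variables, hence derivable implications both ways instead
    of an equality. *)
Lemma QCKLm_rename_comp (phi : form) (s t : nat -> nat) :
  QCKLm (Imp (rename t (rename s phi)) (rename (t \o s) phi)) /\
  QCKLm (Imp (rename (t \o s) phi) (rename t (rename s phi))).
Proof.
elim: phi s t => [n k xs| | |a IHa b IHb|a IHa|x a IHa|a IHa|a IHa] s t.
- suff -> : rename t (rename s (Atom k xs)) = rename (t \o s) (Atom k xs).
    by split; apply: QCKLm_id.
  by congr Atom; apply: val_inj; rewrite /= map_comp.
- by split; apply: QCKLm_id.
- by split; apply: QCKLm_id.
- have [a1 a2] := IHa s t; have [b1 b2] := IHb s t.
  split; [apply: (QCKLm_prop2 a1 b1)|apply: (QCKLm_prop2 a2 b2)] => v bv;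
    rewrite !boolean_valuation_Imp //=; case: bv => _ _ vA _; rewrite !vA; tauto.
- have [a1 a2] := IHa s t.
  split; [apply: (QCKLm_prop1 a2)|apply: (QCKLm_prop1 a1)] => v bv;
    rewrite !boolean_valuation_Imp //=; case: bv => _ _ _ vN; rewrite !vN; tauto.
- rewrite /=; set z := fresh (map s _) x; set w := fresh (map t _) z.
  set w' := fresh _ x.
  have zN : z \notin map s [seq y <- fv a | y != x] by exact: fresh_notin.
  have wN : w \notin map t [seq y <- fv (rename [eta s with x |-> z] a) | y != z].
    exact: fresh_notin.
  have w'N : w' \notin map (t \o s) [seq y <- fv a | y != x].
    exact: fresh_notin.
  have zs y : y \in fv a -> y != x -> s y != z.
    move=> ya yx; apply: contraNneq zN => <-.
    by apply: map_f; rewrite mem_filter yx.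
  have ts_w y : y \in fv a -> y != x -> t (s y) != w.
    move=> ya yx; apply: contraNneq wN => <-; apply/map_f.
    rewrite mem_filter zs //= mem_fv_rename; apply/mapP; exists y => //=.
    by rewrite (negbTE yx).
  have ts_w' y : y \in fv a -> y != x -> t (s y) != w'.
    move=> ya yx; apply: contraNneq w'N => <-.
    by apply: (map_f (t \o s)); rewrite mem_filter yx.
  have comp_upd u : rename ([eta t with z |-> u] \o [eta s with x |-> z]) a =
      rename [eta t \o s with x |-> u] a.
    apply: eq_rename => y ya /=; case: (eqVneq y x) => [_|yx] /=.
      by rewrite eqxx.
    by rewrite (negbTE (zs _ ya yx)).
  (* Renaming the bound variable: both sides are [All u (a[x := u])] for some
     [u] that is fresh for the other free variables. *)
  have alpha u u' : (forall y, y \in fv a -> y != x -> t (s y) != u) ->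
      (forall y, y \in fv a -> y != x -> t (s y) != u') ->
      QCKLm (Imp (All u (rename [eta t \o s with x |-> u] a))
                 (All u' (rename [eta t \o s with x |-> u'] a))).
    move=> uN u'N; apply: QCKLm_gen_Imp.
      rewrite /= mem_filter mem_fv_rename; apply/negP => /andP[u'u /mapP[y ya /=]].
      case: (eqVneq y x) => [_ uu|yx]; first by rewrite uu eqxx in u'u.
      by move=> /esym/eqP; apply/negP/u'N.
    apply: QCKLm_trans (QCKLm_inst u u' _) _.
    have [+ _] := IHa [eta t \o s with x |-> u] [eta id with u |-> u'].
    suff -> : rename ([eta id with u |-> u'] \o [eta t \o s with x |-> u]) a =
      rename [eta t \o s with x |-> u'] a by [].
    apply: eq_rename => y ya /=; case: (eqVneq y x) => [_|yx] /=.
      by rewrite eqxx.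
    by rewrite (negbTE (uN _ ya yx)).
  have [a1 a2] := IHa [eta s with x |-> z] [eta t with z |-> w].
  rewrite comp_upd in a1 a2; split.
    exact: QCKLm_trans (QCKLm_All_mono w a1) (alpha _ _ ts_w ts_w').
  exact: QCKLm_trans (alpha _ _ ts_w' ts_w) (QCKLm_All_mono w a2).
- by have [a1 a2] := IHa s t; split; apply: QCKLm_E_mono.
- by have [a1 a2] := IHa s t; split; apply: QCKLm_C_mono.
Qed.

(** * Completeness *)

(** Treats both kinds of infinite meets uniformly; every other formula is its own single
    conjunct. *)
Definition conjuncts (psi : form) : set form :=
  match psi with
  | CBox chi => range (fun n => iter n EBox chi)
  | All x chi => range (fun y => rename [eta id with x |-> y] chi)
  | _ => [set psi]
  end.

Lemma QCKLm_conjuncts (psi chi : form) :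
  conjuncts psi chi -> QCKLm (Imp psi chi).
Proof.
case: psi => [n k xs| | |a b|a|x a|a|a] /= => [->|->|->|->|->|[y _ <-]|->|[n _ <-]];
  by [exact: QCKLm_id|exact: QCKLm_inst|exact: QCKLm_C_iterE].
Qed.

(* For [All x chi], the premise is used at a variable fresh for [gamma] and
   [chi]. *)
Lemma QCKLm_meet (gamma psi : form) :
  (forall chi, conjuncts psi chi -> QCKLm (Imp gamma chi)) ->
  QCKLm (Imp gamma psi).
Proof.
case: psi => [n k xs| | |a b|a|x a|a|a] /= h; try exact: h.
  pose y := fresh (fv gamma ++ fv a) x.
  have := fresh_notin (fv gamma ++ fv a) x.
  rewrite -/y mem_cat negb_or => /andP[yg ya].
  have hy : QCKLm (Imp gamma (rename [eta id with x |-> y] a)).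
    by apply: h; exists y.
  apply: QCKLm_trans (QCKLm_gen_Imp yg hy) _.
  apply: QCKLm_gen_Imp.
    rewrite /= mem_filter mem_fv_rename; apply/negP => /andP[xy /mapP[u ua /=]].
    by case: (eqVneq u x) => [_ xyE|ux xu]; [rewrite xyE eqxx in xy|rewrite xu eqxx in ux].
  apply: QCKLm_trans (QCKLm_inst y x _) _.
  (* Renaming [x] to [y] and back fixes every free variable of [a], because [y] is not among
     them. *)
  have [+ _] := QCKLm_rename_comp a [eta id with x |-> y] [eta id with y |-> x].
  rewrite [rename (_ \o _) _]rename_id // => u ua /=.
  case: (eqVneq u x) => [->|ux] /=; first by rewrite eqxx.
  by case: eqVneq => // uy; rewrite -uy ua in ya.
by apply: QCKLm_omega => n; apply: h; exists n.
Qed.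

Definition saturated (w : form -> Prop) : Prop :=
  [/\ boolean_valuation w, forall phi, QCKLm phi -> w phi &
      forall psi, (forall chi, conjuncts psi chi -> w chi) -> w psi].

Definition consistent (gamma : form) : Prop := ~ QCKLm (Neg gamma).

(** If [gamma] refutes [psi], it cannot derive every conjunct of [psi], or by [QCKLm_meet] it would
    derive [psi]; so some conjunct can be denied consistently. *)
Lemma consistent_split (gamma psi : form) : consistent gamma ->
  exists2 gamma', consistent gamma' &
    QCKLm (Imp gamma' gamma) /\
    (QCKLm (Imp gamma' psi) \/
     exists2 chi, conjuncts psi chi & QCKLm (Imp gamma' (Neg chi))).
Proof.
move=> cg.
have projl a b : QCKLm (Imp (And a b) a).
  apply: QCKLm_prop => v bv; rewrite boolean_valuation_Imp //.
  by case: bv => _ _ -> _ [].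
have projr a b : QCKLm (Imp (And a b) b).
  apply: QCKLm_prop => v bv; rewrite boolean_valuation_Imp //.
  by case: bv => _ _ -> _ [].
have [inc|c] := pselect (QCKLm (Neg (And gamma psi))); last first.
  by exists (And gamma psi) => //; split=> //; left.
have [[chi [pc c]]|no] := pselect (exists chi, conjuncts psi chi /\
    consistent (And gamma (Neg chi))).
  by exists (And gamma (Neg chi)) => //; split=> //; right; exists chi.
case: cg; have gpsi : QCKLm (Imp gamma psi).
  (* [Imp gamma chi] unfolds to [Neg (And gamma (Neg chi))], so its underivability is the
     consistency that [no] excludes. *)
  apply: QCKLm_meet => chi pc; apply: contrapT => nc; apply: no.
  by exists chi.
apply: (QCKLm_prop2 inc gpsi) => v bv; rewrite boolean_valuation_Imp //.
by case: bv => _ _ vA vN; rewrite !vN vA; tauto.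
Qed.

(* Rasiowa-Sikorski: there are countably many formulas, hence countably many
   meets to preserve, and they can be dealt with one after the other. *)
Lemma saturated_exists (gamma : form) : consistent gamma ->
  exists2 w, saturated w & w gamma.
Proof.
move=> cg; have [decode dK] := code_decode.
have ex (p : nat * {g | consistent g}) : exists g' : {g | consistent g},
    QCKLm (Imp (sval g') (sval p.2)) /\
    (QCKLm (Imp (sval g') (decode p.1)) \/
     exists2 chi, conjuncts (decode p.1) chi &
       QCKLm (Imp (sval g') (Neg chi))).
  case: p => n [g cong] /=.
  by have [g' cg' h] := consistent_split (decode n) cong; exists (exist _ g' cg').
have [step stepP] := choice ex.
pose st := fix st n : {g | consistent g} :=
  if n is m.+1 then step (m, st m) else exist _ gamma cg.
(* The filter generated by the chain, whose stage [m.+1] has settled [decode m]. *)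
pose w phi := exists n, QCKLm (Imp (sval (st n)) phi).
have st_mono m n : m <= n -> QCKLm (Imp (sval (st n)) (sval (st m))).
  move=> /subnK <-; elim: (n - m) => [|d IH]; first exact: QCKLm_id.
  by rewrite addSn; apply: QCKLm_trans IH; case: (stepP (d + m, st (d + m))).
have w_mono m n phi : m <= n -> QCKLm (Imp (sval (st m)) phi) ->
    QCKLm (Imp (sval (st n)) phi).
  by move=> mn; apply: QCKLm_trans; apply: st_mono.
have w_th phi : QCKLm phi -> w phi.
  move=> h; exists 0; apply: (QCKLm_prop1 h) => v bv.
  by rewrite boolean_valuation_Imp.
have w_prop2 a b phi : w a -> w b ->
    (forall v, boolean_valuation v -> v a -> v b -> v phi) -> w phi.
  move=> [m ha] [n hb] h; exists (maxn m n).
  apply: (QCKLm_prop2 (w_mono _ _ _ (leq_maxl m n) ha)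
                      (w_mono _ _ _ (leq_maxr m n) hb)) => v bv.
  by rewrite !boolean_valuation_Imp // => va vb vs; apply: h => //; auto.
have w_Bot : ~ w Bot.
  move=> [n h]; have := svalP (st n); apply; apply: (QCKLm_prop1 h) => v bv.
  by rewrite boolean_valuation_Imp //; case: bv => _ vB _ vN; rewrite vN => k /k.
have w_decide psi : w psi \/ exists2 chi, conjuncts psi chi & w (Neg chi).
  have := stepP (code psi, st (code psi)).
  rewrite /= dK => -[_ [wpsi|[chi pc wNc]]]; first by left; exists (code psi).+1.
  by right; exists chi => //; exists (code psi).+1.
have w_contra a : w a -> ~ w (Neg a).
  move=> wa wNa; apply: w_Bot; apply: (w_prop2 _ _ _ wa wNa) => v bv va.
  by case: bv => _ _ _ ->.
have w_conj psi chi : conjuncts psi chi -> w psi -> w chi.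
  move=> /QCKLm_conjuncts/w_th h wpsi.
  apply: (w_prop2 _ _ _ h wpsi) => v bv.
  by rewrite boolean_valuation_Imp.
exists w; last by exists 0; apply: QCKLm_id.
split=> //; first split=> //.
- by apply/w_th/QCKLm_prop => v [].
- move=> a b; split=> [wab|[wa wb]].
    by split; apply: (w_prop2 _ _ _ wab wab) => v [_ _ vA _] /vA[].
  by apply: (w_prop2 _ _ _ wa wb) => v [_ _ vA _] va vb; apply/vA.
- move=> a; split=> [wNa wa|nwa]; first exact: w_contra wNa.
  (* Since [a] implies its conjunct [chi], the denial of [chi] entails that of [a]. *)
  have [//|[chi pc wNc]] := w_decide a.
  have wi := w_th _ (QCKLm_conjuncts pc).
  apply: (w_prop2 _ _ _ wi wNc) => v bv; rewrite boolean_valuation_Imp //.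
  by case: bv => _ _ _ vN; rewrite !vN; tauto.
- move=> psi h; have [//|[chi pc wNc]] := w_decide psi.
  by case: (w_contra chi) => //; apply: h.
Qed.

(** * The canonical frame *)

Definition canonical_world : Type := {w : form -> Prop | saturated w}.

Definition truth_set (phi : form) : set canonical_world :=
  [set w | sval w phi].

(** Otherwise [And phi (Neg psi)] is consistent and lies in some saturated set. *)
Lemma truth_set_subset (phi psi : form) :
  truth_set phi `<=` truth_set psi -> QCKLm (Imp phi psi).
Proof.
move=> sub; apply: contrapT => np.
have [//|w sw] := @saturated_exists (And phi (Neg psi)).
have [[_ _ vA vN] _ _] := sw; move=> /vA[wphi /vN]; apply.
exact: (sub (exist _ w sw)).
Qed.

Section Canonical.
Variable w0 : canonical_world.

Definition canonical_E (X : set canonical_world) : set canonical_world :=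
  [set w | exists2 psi, sval w (EBox psi) & truth_set psi `<=` X].

(* [C] has to be the meet of the iterates of [E] on all sets of worlds, not
   only on the truth sets, so it is defined to be that meet. *)
Definition canonical_frame : nbhd_frame :=
  @NbhdFrame canonical_world (ex_intro _ w0 Logic.I)
    (fun w X => canonical_E X w)
    (fun w X => forall n, iter n canonical_E X w).

Lemma canonical_E_setI (X Y : set canonical_world) :
  canonical_E (X `&` Y) = canonical_E X `&` canonical_E Y.
Proof.
apply/seteqP; split=> [w [psi wE sub]|w [[a wa suba] [b wb subb]]].
  by split; exists psi => // u /sub[].
have [bw wth _] := svalP w; exists (And a b).
  have ab : QCKLm (Imp a (Imp b (And a b))).
    apply: QCKLm_prop => v bv; rewrite !boolean_valuation_Imp //.
    by case: bv => _ _ -> _.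
  have /wth := QCKLm_trans (QCKLm_E_mono ab) (QCKLm_E_K b (And a b)).
  by rewrite !boolean_valuation_Imp //; apply.
have sub u : truth_set (And a b) u -> truth_set a u /\ truth_set b u.
  by have [[_ _ vA _] _ _] := svalP u; move=> /vA.
by move=> u /sub[/suba ? /subb].
Qed.

Lemma canonical_E_setT : canonical_E setT = setT.
Proof.
apply/seteqP; split=> // w _; exists Top => //; have [_ wth _] := svalP w.
by apply/wth/QCKLm_necE/QCKLm_prop => v [].
Qed.

(** Normality of all iterates passes to their intersection, the operator for [CBox]. *)
Lemma iter_canonical_E_setI n (X Y : set canonical_world) :
  iter n canonical_E (X `&` Y) = iter n canonical_E X `&` iter n canonical_E Y.
Proof. by elim: n => //= n ->; rewrite canonical_E_setI. Qed.

Lemma iter_canonical_E_setT n : iter n canonical_E setT = setT.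
Proof. by elim: n => //= n ->; rewrite canonical_E_setT. Qed.

Lemma canonical_CKLm_frame : CKLm_frame canonical_frame.
Proof.
split.
- move=> S; split.
    exists (\bigcup_(X in S) X); split=> [X SX|Y ubY]; apply/subsetPset.
      exact: bigcup_sup.
    by apply: bigcup_sub => X /ubY /subsetPset.
  exists (\bigcap_(X in S) X); split=> [X SX|Y lbY]; apply/subsetPset.
    exact: bigcap_inf.
  by apply: sub_bigcap => X /lbY /subsetPset.
- split=> [X Y|]; [exact: canonical_E_setI|exact: canonical_E_setT].
- split=> [X Y|]; apply/seteqP; split=> // w.
  + by move=> h; split=> n; have := h n; rewrite iter_canonical_E_setI => -[].
  + by move=> [hX hY] n; rewrite iter_canonical_E_setI; split.
  + by move=> _ n; rewrite iter_canonical_E_setT.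
- move=> X; split=> [_ [n _ <-]|Y lbY]; apply/subsetPset => w.
    exact.
  move=> Yw n; have /lbY/subsetPset/(_ w Yw) :
    range (fun m => iter m (@alg_E canonical_frame) X)
      (iter n (@alg_E canonical_frame) X) by exists n.
  exact.
Qed.

(** Inclusion of truth sets is derivability, and [EBox] is monotone for it, so a smaller truth set
    gives nothing new. *)
Lemma canonical_E_truth_set (phi : form) :
  canonical_E (truth_set phi) = truth_set (EBox phi).
Proof.
apply/seteqP; split=> w; last by move=> wE; exists phi.
move=> [psi wE /truth_set_subset/QCKLm_E_mono h].
have [bw wth _] := svalP w.
by have /(boolean_valuation_Imp _ _ bw) := wth _ h; apply.
Qed.

Lemma iter_canonical_E_truth_set n (phi : form) :
  iter n canonical_E (truth_set phi) = truth_set (iter n EBox phi).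
Proof. by elim: n => //= n ->; rewrite canonical_E_truth_set. Qed.

Definition canonical_interp (n k : nat) (w : canonical_world) :
  set (n.-tuple nat) := [set xs | sval w (Atom k xs)].

Lemma truth_set_conjuncts (psi : form) :
  truth_set psi = \bigcap_(chi in conjuncts psi) truth_set chi.
Proof.
apply/seteqP; split=> w; have [bw wth wmeet] := svalP w; last exact: wmeet.
move=> wpsi chi /QCKLm_conjuncts/wth/(boolean_valuation_Imp _ _ bw).
exact.
Qed.

(** The truth lemma. With variables as domain, an assignment is itself a renaming; the induction
    ranges over all of them to pass binders. *)
Lemma value_canonical (s : nat -> nat) (phi : form) :
  @value canonical_frame nat canonical_interp s phi = truth_set (rename s phi).
Proof.
elim: phi s => [n k xs| | |a IHa b IHb|a IHa|x a IHa|a IHa|a IHa] s //=.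
- by apply/seteqP; split=> // w _; have [[]] := svalP w.
- by apply/seteqP; split=> // w; have [[]] := svalP w.
- rewrite IHa IHb; apply/seteqP.
  by split=> w; have [[_ _ vA _] _ _] := svalP w => /vA.
- rewrite IHa; apply/seteqP.
  by split=> w; have [[_ _ _ vN] _ _] := svalP w => /vN.
- set z := fresh _ _; rewrite truth_set_conjuncts /= bigcap_image.
  apply: eq_bigcapr => y _; rewrite IHa.
  have eq : rename ([eta id with z |-> y] \o [eta s with x |-> z]) a =
      rename [eta s with x |-> y] a.
    apply: eq_rename => u ua /=; case: (eqVneq u x) => [_|ux] /=.
      by rewrite eqxx.
    case: eqVneq => // suz.
    have := fresh_notin (map s [seq y <- fv a | y != x]) x.
    by rewrite -/z -suz map_f // mem_filter ux.
  (* The two instances agree only up to derivable equivalence, which worlds respect. *)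
  have [] := QCKLm_rename_comp a [eta s with x |-> z] [eta id with z |-> y].
  rewrite eq => h1 h2; apply/seteqP; split=> w; have [bw wth _] := svalP w.
    by have /(boolean_valuation_Imp _ _ bw) := wth _ h2.
  by have /(boolean_valuation_Imp _ _ bw) := wth _ h1.
- by rewrite IHa; exact: canonical_E_truth_set.
- rewrite IHa (truth_set_conjuncts (CBox _)) /= bigcap_image.
  apply/seteqP; split=> w h n => [_|].
    by rewrite -iter_canonical_E_truth_set; apply: h.
  by rewrite iter_canonical_E_truth_set; apply: h.
Qed.

End Canonical.

Theorem theorem7p4 (phi : form) :
  QCKLm phi <-> (forall Z : nbhd_frame, CKLm_frame Z -> valid Z phi).
Proof.
split=> [dphi Z ZF|vphi]; first exact: soundness.
apply: (QCKLm_MP (phi := Top)); first by apply: QCKLm_prop => v [].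
(* The inclusion to be shown supplies the world [w] that makes the canonical frame nonempty. *)
apply: truth_set_subset => w _.
have := vphi _ (canonical_CKLm_frame w) nat (ex_intro _ 0 Logic.I)
  canonical_interp id.
(* Under the identity assignment the value of [phi] is its own truth set. *)
by rewrite value_canonical rename_id // => ->.
Qed.
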